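(* For every positive integer $v$, no $egr(v,4,5,8)$-graph exists. For every positive integer $v$, no $egr(v,6,5,24)$-graph exists.
   Context: Graphs are finite, simple and undirected. For integers $v,k,g,\lambda$, an $egr(v,k,g,\lambda)$-graph (edge-girth-regular graph) is a $k$-regular graph on $v$ vertices with girth $g$ (the length of a shortest cycle is exactly $g$) such that every edge is contained in exactly $\lambda$ cycles of length $g$. *)

(* Defs.v *)
From mathcomp Require Import all_boot.

Set Implicit Arguments.
Unset Strict Implicit.
Unset Printing Implicit Defensive.

Record sgraph := SGraph {
  vertex :> finType;
  adj : rel vertex;
  adj_sym : symmetric adj;
  adj_irrefl : irreflexive adj
}.

Section Graph.
Variable G : sgraph.

Definition neighbours (x : G) : {set G} := [set y | adj x y].

Definition regular (k : nat) : Prop := forall x : G, #|neighbours x| = k.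

Definition edges : {set {set G}} :=
  [set [set p.1; p.2] | p : G * G & adj p.1 p.2].

(* The unordered pairs of cyclically consecutive entries of s. *)
Definition cycle_edges (s : seq G) : {set {set G}} :=
  [set [set x; next s x] | x in s].

(* A cycle is a subgraph, identified with its edge set, so that it is not
   counted once per starting point and orientation.  The bound 2 < n is needed
   because ucycle also accepts [:: x; y] whenever x and y are adjacent. *)
Definition cycles (n : nat) : {set {set {set G}}} :=
  [set C | (2 < n) &&
     [exists s : n.-tuple G, ucycleb (@adj G) s && (C == cycle_edges s)]].

Definition has_girth (g : nat) : Prop :=
  cycles g != set0 /\ (forall n : nat, cycles n != set0 -> g <= n).

Definition egr (v k g lambda : nat) : Prop :=
  [/\ #|G| = v,
      regular k,
      has_girth g &
      forall E : {set G}, E \in edges ->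
        #|[set C in cycles g | E \in C]| = lambda].

End Graph.

(* Main.v *)
Require Import Defs.
From mathcomp Require Import all_boot.
From mathcomp Require Import zify.

(** In both cases lambda = k(k-2) = (k-1)^2 - 1, one less than the value reached
    by Moore graphs.  Every edge x u thus starts exactly one path x u v z with
    d(x,z) = 3, so k edges join the spheres of radius 2 and 3 around x.
    Uniqueness also gives that a vertex z of the 3-sphere S has at most one
    neighbour outside the ball of radius 3, and none if it has two neighbours in
    the 2-sphere.  As S spans no triangle and no square, counting degrees inside
    S yields |S| = 1 for k > 3; the component of x is then this ball, of order
    k^2 + 2.  Rotation acts freely on the closed 5-walks of the component, so 5
    divides (k^2+2) k . k(k-2), which fails for k = 4 and k = 6. *)

Set Implicit Arguments.
Unset Strict Implicit.
Unset Printing Implicit Defensive.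

(** * Counting pairs, and equality of unordered pairs *)

Lemma card_sigma (A B : finType) (P : pred A) (R : A -> pred B) :
  #|[set p : A * B | P p.1 && R p.1 p.2]| = \sum_(x | P x) #|[set y | R x y]|.
Proof.
rewrite -sum1_card; under [RHS]eq_bigr do rewrite -sum1_card.
by rewrite pair_big_dep; apply: eq_bigl => -[x y]; rewrite !inE.
Qed.

Lemma eq_set2 (T : finType) (x y z t : T) :
  ([set x; y] == [set z; t]) = (x == z) && (y == t) || (x == t) && (y == z).
Proof.
apply/eqP/idP => [/setP E|/orP[] /andP[/eqP-> /eqP->] //]; last exact: setUC.
move: (E x) (E y) (E z) (E t); rewrite !inE !eqxx !orbT.
rewrite !(eq_sym z) !(eq_sym t).
by case: (x == z); case: (x == t); case: (y == z); case: (y == t).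
Qed.

(** * The 5-cycles through an edge as closed walks *)

Section CyclesThroughAnEdge.
Variable G : sgraph.
Implicit Types x y z u v w a b : G.

Definition triangle_free :=
  forall x y z, adj x y -> adj y z -> adj z x -> False.

Definition square_free :=
  forall x y a b, adj x a -> adj x b -> adj y a -> adj y b -> a != b -> x = y.

(* A triple (b, w, a) stands for the closed walk u v b w a u.  Distinctness of
   the vertices is not required: in girth 5 every closed 5-walk is a cycle. *)
Definition closed_walks u v : {set G * G * G} :=
  [set t | [&& adj v t.1.1, adj t.1.1 t.1.2, adj t.1.2 t.2 & adj t.2 u]].

Lemma adj_neq x y : adj x y -> x != y.
Proof. by apply: contraTneq => ->; rewrite adj_irrefl. Qed.

Lemma cycle_mem_cycles (s : seq G) :
  2 < size s -> ucycle (@adj G) s -> cycle_edges s \in cycles G (size s).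
Proof.
move=> lt2s cs; rewrite inE lt2s; apply/existsP.
by exists (in_tuple s); rewrite eqxx andbT.
Qed.

Lemma girth_triangle_free g : 3 < g -> has_girth G g -> triangle_free.
Proof.
move=> g3 [_ gP] x y z xy yz zx.
have /gP : cycles G 3 != set0; last by rewrite leqNgt g3.
apply/set0Pn; exists (cycle_edges [:: x; y; z]).
apply: (@cycle_mem_cycles [:: x; y; z]) => //; apply/andP.
rewrite /= xy yz zx !inE !negb_or (adj_neq xy) (adj_neq yz).
by rewrite eq_sym (adj_neq zx).
Qed.

Lemma girth_square_free g : 4 < g -> has_girth G g -> square_free.
Proof.
move=> g4 [_ gP] x y a b xa xb ya yb ab; apply/eqP/contraT => xy.
have /gP : cycles G 4 != set0; last by rewrite leqNgt g4.
apply/set0Pn; exists (cycle_edges [:: x; a; y; b]).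
apply: (@cycle_mem_cycles [:: x; a; y; b]) => //; apply/andP.
rewrite /= !inE !negb_or xa yb (adj_sym a) ya (adj_sym b) xb xy ab.
by rewrite !adj_neq // adj_sym.
Qed.

Lemma cycle_edges_rot n (s : seq G) :
  uniq s -> cycle_edges (rot n s) = cycle_edges s.
Proof.
move=> us; apply/setP => E; apply/imsetP/imsetP => -[x xs ->].
  by exists x; rewrite ?next_rot // -(mem_rot n).
by exists x; rewrite ?next_rot // mem_rot.
Qed.

Lemma cycle_edges5 (a b c d e : G) : uniq [:: a; b; c; d; e] ->
  cycle_edges [:: a; b; c; d; e] =
  [set [set a; b]; [set b; c]; [set c; d]; [set d; e]; [set e; a]].
Proof.
rewrite /= !inE !negb_or => /and5P[/and4P[ab ac ad ae] /and3P[bc bd be]].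
move=> /andP[cd ce] de _.
have nE : [/\ next [:: a; b; c; d; e] a = b, next [:: a; b; c; d; e] b = c,
  next [:: a; b; c; d; e] c = d, next [:: a; b; c; d; e] d = e &
  next [:: a; b; c; d; e] e = a].
  have N x y : x != y -> (y == x) = false by rewrite eq_sym => /negPf.
  by rewrite /= !eqxx !(N _ _ ab, N _ _ ac, N _ _ ad, N _ _ ae, N _ _ bc,
    N _ _ bd, N _ _ be, N _ _ cd, N _ _ ce, N _ _ de).
case: nE => na nb nc nd ne.
apply/setP => E; rewrite !inE -!orbA; apply/imsetP/idP.
  case=> x; rewrite !inE => /or4P[||| /orP[]] /eqP -> ->;
  by rewrite ?(na, nb, nc, nd, ne) eqxx ?orbT.
case/or4P=> [||| /orP[]] /eqP ->.
- by exists a; rewrite ?na // !inE eqxx.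
- by exists b; rewrite ?nb // !inE eqxx !orbT.
- by exists c; rewrite ?nc // !inE eqxx !orbT.
- by exists d; rewrite ?nd // !inE eqxx !orbT.
- by exists e; rewrite ?ne // !inE eqxx !orbT.
Qed.

(** Recovers the two cycle neighbours of the first vertex from the edge set alone; after a rotation
    it serves for any other vertex. *)
Lemma edge_in_cycle5 (a b c d e x : G) : uniq [:: a; b; c; d; e] ->
  ([set a; x] \in cycle_edges [:: a; b; c; d; e]) = (x == b) || (x == e).
Proof.
move=> us; rewrite cycle_edges5 // !inE !eq_set2.
move: us; rewrite /= !inE !negb_or => /and5P[/and4P[ab ac ad ae] _ _ _ _].
rewrite eqxx (negPf ab) (negPf ac) (negPf ad) (negPf ae) /=.
by rewrite ?orbF ?andbF ?orbF.
Qed.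

(** If two vertices two steps apart on a closed 5-walk coincided, the other three edges would form a
    triangle. *)
Lemma closed_walks_ucycle u v b w a : triangle_free ->
  adj u v -> (b, w, a) \in closed_walks u v ->
  ucycle (@adj G) [:: u; v; b; w; a].
Proof.
move=> tri uv; rewrite inE /= => /and4P[vb bw wa au].
have N (p q r x : G) : adj p q -> adj q r -> adj r x -> p != x.
  move=> pq qr rx; apply/eqP => px; move: rx; rewrite -px.
  exact: tri pq qr.
have [ub uw] := (N _ _ _ _ bw wa au, N _ _ _ _ uv vb bw).
have [[vw va] ba] := (N _ _ _ _ wa au uv, N _ _ _ _ vb bw wa, N _ _ _ _ au uv vb).
have [[[n1 n2] n3] n4] := (adj_neq uv, adj_neq vb, adj_neq bw, adj_neq wa).
have n5 := adj_neq au.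
rewrite /ucycle /= uv vb bw wa au !inE !negb_or n1 n2 n3 n4 (eq_sym u a) n5 /=.
by rewrite (eq_sym u b) (eq_sym v w) (eq_sym b a) ub uw vw va ba.
Qed.

Definition walk_cycle u v (t : G * G * G) : {set {set G}} :=
  cycle_edges [:: u; v; t.1.1; t.1.2; t.2].

(** The edge set determines [a] as the second neighbour of [u] and, after rotating [v] to the front,
    [b] as that of [v]. Then [w] is the only common neighbour of [a] and [b], by the absence of
    squares. *)
Lemma walk_cycle_inj u v : triangle_free -> square_free -> adj u v ->
  {in closed_walks u v &, injective (walk_cycle u v)}.
Proof.
move=> tri sq uv [[b w] a] [[b' w'] a'] t1 t2 E.
have /ucycle_uniq u1 := closed_walks_ucycle tri uv t1.
have /ucycle_uniq u2 := closed_walks_ucycle tri uv t2.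
have aa' : a = a'.
  have : [set u; a] \in walk_cycle u v (b', w', a').
    by rewrite -E edge_in_cycle5 // eqxx orbT.
  rewrite edge_in_cycle5 // => /orP[]/eqP // av.
  by move: u1; rewrite /= av !inE eqxx !orbT /= andbF.
have r1 : uniq (rot 1 [:: u; v; b; w; a]) by rewrite rot_uniq.
have r2 : uniq (rot 1 [:: u; v; b'; w'; a']) by rewrite rot_uniq.
have bb' : b = b'.
  have : [set v; b] \in cycle_edges (rot 1 [:: u; v; b'; w'; a']).
    rewrite cycle_edges_rot // -[cycle_edges _]/(walk_cycle _ _ (b', w', a')).
    rewrite -E -[walk_cycle _ _ _]/(cycle_edges [:: u; v; b; w; a]).
    by rewrite -(cycle_edges_rot 1) // (edge_in_cycle5 _ r1) eqxx.
  rewrite (edge_in_cycle5 _ r2) => /orP[]/eqP // bu.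
  by move: u1; rewrite /= bu !inE eqxx !orbT.
subst a' b'; congr (_, _, _).
move: t1 t2 u1; rewrite !inE /= !negb_or.
case/and4P=> _ bw wa _ /and4P[_ bw' wa' _] /and5P[_ _ /andP[_ /andP[ba _]] _ _].
by apply: (sq _ _ b a); rewrite ?ba // adj_sym.
Qed.

Lemma card_cycles_edge u v : triangle_free -> square_free -> adj u v ->
  #|[set C in cycles G 5 | [set u; v] \in C]| = #|closed_walks u v|.
Proof.
move=> tri sq uv.
rewrite -(card_in_imset (walk_cycle_inj tri sq uv)); congr #|pred_of_set _|.
apply/setP => C; rewrite inE; apply/andP/imsetP; last first.
  case=> -[[b w] a] tT ->.
  have cs := closed_walks_ucycle tri uv tT.
  split; first exact: (@cycle_mem_cycles [:: u; v; b; w; a]).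
  by rewrite edge_in_cycle5 ?eqxx // (ucycle_uniq cs).
rewrite inE /= => -[/existsP[s /andP[cs /eqP ->{C}]]].
case/imsetP => x xs E.
have us := ucycle_uniq cs.
have [i s' ds] := rot_to xs.
have : ucycle (@adj G) (x :: s') by rewrite -ds rot_ucycle.
rewrite -(cycle_edges_rot i us) ds.
have : size (x :: s') = 5 by rewrite -ds size_rot size_tuple.
have {E} : [set u; v] = [set x; next (x :: s') x] by rewrite -ds next_rot.
case: s' ds => [|y [|c [|d [|e []]]]] //= ds; rewrite eqxx => E _ cs'.
have /andP[/and5P[xy yc cd de /andP[ex _]] us'] := cs'.
move/eqP: E; rewrite eq_set2 => /orP[] /andP[/eqP dx /eqP dy]; subst x y.
  by exists (c, d, e) => //; rewrite inE /= yc cd de.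
(* This cycle runs from [v] to [u], so it is read backwards to start with [u v]. *)
exists (e, d, c) => /=.
  rewrite inE /= (adj_sym v e) (adj_sym e d) (adj_sym d c) (adj_sym c u).
  by rewrite ex de cd yc.
rewrite /walk_cycle /= !cycle_edges5 //; last first.
  by rewrite -[[:: u; _; _; _; _]]/(rot 3 (rev [:: v; u; c; d; e]))
    rot_uniq rev_uniq.
rewrite (setUC [set v] [set u]) (setUC [set u] [set c]) (setUC [set c] [set d]).
rewrite (setUC [set d] [set e]) (setUC [set e] [set v]).
apply/setP => E; rewrite !inE.
by do 5![case: (E == _)].
Qed.
End CyclesThroughAnEdge.

(** * Paths to vertices at distance 3 *)

Section DistanceThree.
Variables (G : sgraph) (k : nat).
Hypotheses (k_gt3 : 3 < k) (reg : regular G k).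
Hypotheses (tri : triangle_free G) (sq : square_free G).
Hypothesis card_walks :
  forall u v : G, adj u v -> #|closed_walks u v| = k * (k - 2).
Implicit Types u v w x y z : G.

(** Distance 2 for distinct vertices, by the absence of triangles. Since degrees are positive,
    [meet x x] also holds. *)
Definition meet x z := [exists w, adj x w && adj w z].

Lemma meetP x z : reflect (exists2 w, adj x w & adj w z) (meet x z).
Proof.
by apply: (iffP existsP) => -[w]; [case/andP; exists w|exists w; apply/andP].
Qed.

Lemma meet_sym x z : meet x z = meet z x.
Proof.
by apply/meetP/meetP => -[w xw wz]; exists w; rewrite adj_sym.
Qed.

Lemma adj_meet x z : adj x z -> ~~ meet x z.
Proof.
by move=> xz; apply/meetP => -[w xw wz]; apply: (tri xw wz); rewrite adj_sym.
Qed.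

Lemma card_neighbours_but x y : adj x y ->
  #|[set z | adj x z && (z != y)]| = k.-1.
Proof.
move=> xy; rewrite -(reg x) [in RHS](cardsD1 y) inE xy /=.
by apply: eq_card => z; rewrite !inE andbC.
Qed.

(** The pair [(v, z)] stands for the path [x u v z]. When [adj x u], the last clause also rules out
    [z = x], and [adj x z] would close a square, so [z] is at distance 3. *)
Definition geodesics x u : {set G * G} :=
  [set p | [&& adj u p.1, p.1 != x, adj p.1 p.2, p.2 != u & ~~ meet x p.2]].

(* Of the (k-1)^2 paths x u v z, those with d(x,z) = 2 close up to a 5-cycle
   through xu in exactly one way. *)
Lemma card_geodesics x u : adj x u -> #|geodesics x u| = 1.
Proof.
move=> xu; have ux : adj u x by rewrite adj_sym.
pose Q := [set p : G * G | (adj u p.1 && (p.1 != x)) &&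
                           (adj p.1 p.2 && (p.2 != u))].
have cQ : #|Q| = k.-1 * k.-1.
  rewrite (@card_sigma _ _ (fun v => adj u v && (v != x))
    (fun v z => adj v z && (z != u))) (eq_bigr (fun=> k.-1)) => [|v /andP[uv _]].
    by rewrite sum_nat_const -cardsE card_neighbours_but.
  by rewrite card_neighbours_but // adj_sym.
have cI : #|Q :&: [set p | meet x p.2]| = k * (k - 2).
  rewrite -(card_walks xu).
  have inj : {in closed_walks x u &, injective (fun t : G * G * G => t.1)}.
    move=> [[v z] w] [[v' z'] w'] /=; rewrite !inE /=.
    move=> /and4P[uv vz zw wx] /and4P[_ _ zw' wx'] [E1 E2]; subst v' z'.
    congr (_, _); apply/eqP/contraT => ww'.
    have zx : z = x by apply: (sq zw zw' _ _ ww'); rewrite adj_sym.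
    by case: (tri xu uv); rewrite -zx.
  rewrite -(card_in_imset inj); apply: eq_card => -[v z].
  apply/idP/imsetP => [|[[[v' z'] w]]]; rewrite !inE /=.
    case/andP=> /andP[/andP[uv vx] /andP[vz zu]] /meetP[w xw wz].
    by exists (v, z, w) => //; rewrite inE /= uv vz adj_sym wz adj_sym xw.
  case/and4P=> uv vz zw wx [-> ->]; rewrite uv vz /=.
  have xv : v' != x.
    by apply/eqP => E; rewrite E in vz; exact: (tri vz zw wx).
  have zu : z' != u.
    by apply/eqP => E; rewrite E in zw; exact: (tri xu zw wx).
  by rewrite xv zu; apply/meetP; exists w; rewrite adj_sym.
have -> : geodesics x u = Q :\: [set p | meet x p.2].
  by apply/setP => -[v z]; rewrite !inE /= -!andbA; do !bool_congr.
apply/eqP; rewrite -(eqn_add2l (k * (k - 2))) -{1}cI cardsID cQ; apply/eqP.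
by case: k k_gt3 => [|[|n]] // _; rewrite subn2 /= addn1 mulSn mulnS; lia.
Qed.

Lemma geodesics_uniq x u v z v' z' : adj x u ->
  (v, z) \in geodesics x u -> (v', z') \in geodesics x u -> v = v' /\ z = z'.
Proof.
move=> /card_geodesics/eqP/cards1P[p ->]; rewrite !inE.
by move=> /eqP<- /eqP[-> ->].
Qed.

Lemma geodesics_sym x u v z : adj x u ->
  (v, z) \in geodesics x u -> (u, x) \in geodesics z v.
Proof.
rewrite !inE /= => xu /and5P[uv vx vz zu nm].
by rewrite (adj_sym v) uv eq_sym zu (adj_sym u) xu eq_sym vx meet_sym.
Qed.

(** * The spheres of radius 2 and 3 *)

Definition sphere2 x : {set G} := [set y | (y != x) && meet x y].

Definition sphere3 x : {set G} :=
  [set z | [&& z != x, ~~ adj x z, ~~ meet x z &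
               [exists v, (v \in sphere2 x) && adj v z]]].

Lemma sphere2P x y : reflect (exists2 u, adj x u & adj u y && (y != x))
  (y \in sphere2 x).
Proof.
rewrite inE; apply: (iffP andP) => [[yx /meetP[u xu uy]]|[u xu /andP[uy yx]]].
  by exists u; rewrite ?uy.
by split=> //; apply/meetP; exists u.
Qed.

Lemma card_common x y : y \in sphere2 x ->
  #|[set u | adj x u && adj u y]| = 1.
Proof.
case/sphere2P=> u xu /andP[uy yx].
apply/eqP/cards1P; exists u; apply/setP => u'; rewrite !inE.
apply/andP/eqP => [[xu' uy']|-> //]; apply/eqP/contraT => uu'.
by rewrite (sq (x := y) (y := x) _ _ xu' xu uu') ?eqxx // adj_sym in yx.
Qed.

Lemma card_sphere2 x : #|sphere2 x| = k * k.-1.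
Proof.
rewrite -sum1_card.
(* Each [y] is counted through its unique common neighbour with [x], so that the sum can be
   regrouped by that neighbour. *)
transitivity (\sum_(y in sphere2 x) \sum_(u | adj x u && adj u y) 1).
  by apply: eq_bigr => y /card_common; rewrite -sum1_card big_set.
rewrite (exchange_big_dep (adj x)) /= => [|y u _ /andP[]//].
rewrite (eq_bigr (fun=> k.-1)) => [|u xu].
  by rewrite sum_nat_const -(reg x) cardsE.
have ux : adj u x by rewrite adj_sym.
rewrite -(card_neighbours_but ux) -sum1_card; apply: eq_bigl => y.
rewrite !inE /= xu andbC; case uy: (adj u y) => //=; case: (y != x) => //=.
by apply/meetP; exists u.
Qed.

Lemma geodesic_end x u v z :
  adj x u -> (v, z) \in geodesics x u -> v \in sphere2 x /\ z \in sphere3 x.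
Proof.
rewrite !inE /= => xu /and5P[uv vx vz zu nm].
have xv : meet x v by apply/meetP; exists u.
split; first by rewrite vx.
rewrite nm; apply/and4P; split=> //.
- by apply/eqP => zx; rewrite zx in vz; apply: (tri xu uv vz).
- apply/negP => xz; move: vx.
  by rewrite (sq (x := v) (y := x) (a := u) (b := z)) ?eqxx // 1?adj_sym // eq_sym.
- by apply/existsP; exists v; rewrite inE vx xv.
Qed.

Lemma sphere3_geodesic x v z : v \in sphere2 x -> z \in sphere3 x ->
  adj v z -> exists2 u, adj x u & (v, z) \in geodesics x u.
Proof.
case/sphere2P=> u xu /andP[uv vx]; rewrite !inE => /and4P[zx nxz nm _] vz.
exists u; rewrite // inE /= uv vx vz nm andbT /=.
by apply: contraNneq nxz => ->.
Qed.

(** * Neighbours of a vertex of the 3-sphere, by distance from the centre *)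

Definition down x z := neighbours z :&: sphere2 x.
Definition across x z := neighbours z :&: sphere3 x.
(** For [z] in [sphere3 x] these are the neighbours at distance 4: none can be [x] or adjacent to
    [x]. *)
Definition up x z := neighbours z :\: (sphere2 x :|: sphere3 x).

Lemma card_neighbours_split x z : #|down x z| + #|across x z| + #|up x z| = k.
Proof.
rewrite -(reg z) -(cardsID (sphere2 x :|: sphere3 x) (neighbours z)).
congr (_ + _); rewrite setIUr cardsU -setIIr.
suff -> : sphere2 x :&: sphere3 x = set0 by rewrite setI0 cards0 subn0.
by apply/setP => y; rewrite !inE; case: (meet x y); rewrite ?andbF.
Qed.

(** An edge [v z] between the two spheres extends to a path [x u v z] for exactly one [u], and each
    of the [k] neighbours [u] starts exactly one such path. *)
Lemma sum_down x : \sum_(z in sphere3 x) #|down x z| = k.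
Proof.
transitivity (\sum_(z in sphere3 x) \sum_(v in down x z)
   \sum_(u | adj x u && adj u v) 1).
  apply: eq_bigr => z _; rewrite -sum1_card; apply: eq_bigr => v.
  by rewrite inE => /andP[_ /card_common]; rewrite -sum1_card big_set.
rewrite pair_big_dep /= (exchange_big_dep (adj x)) /= => [|p u _ /andP[]//].
rewrite (eq_bigr (fun=> 1)) => [|u xu]; first by rewrite sum1_card -(reg x) cardsE.
apply: etrans (card_geodesics xu).
rewrite -(card_imset _ (can_inj swap_pairK)) -sum1_card.
apply: eq_bigl => -[z v] /=; apply/idP/imsetP.
  case/andP=> /andP[zS]; rewrite in_setI inE => /andP[zv vS] /andP[_ uv].
  have [|u' xu' g] := sphere3_geodesic vS zS; first by rewrite adj_sym.
  (* Both are common neighbours of [x] and [v]. *)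
  have uu' : u = u'.
    have /eqP/cards1P[w Ew] := card_common vS; move/setP: Ew => Ew.
    move: (Ew u) (Ew u'); move: g; rewrite !inE /= xu uv xu' /=.
    by case/and5P=> -> _ _ _ _ /esym/eqP-> /esym/eqP->.
  by exists (v, z); rewrite // uu'.
case=> -[v' z'] g [-> ->]; have [vS zS] := geodesic_end xu g.
move: g vS; rewrite inE /= => /and5P[uv _ vz _ _] vS.
by rewrite zS xu uv !in_setI vS inE adj_sym vz.
Qed.

Lemma down_gt0 x z : z \in sphere3 x -> 0 < #|down x z|.
Proof.
rewrite inE => /and4P[_ _ _ /existsP[v /andP[vS vz]]].
by rewrite card_gt0; apply/set0Pn; exists v; rewrite in_setI vS inE adj_sym vz.
Qed.

Lemma down_geodesic x z v : z \in sphere3 x -> v \in down x z ->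
  exists2 u, adj x u & (v, z) \in geodesics x u.
Proof.
move=> zS; rewrite in_setI inE => /andP[zv vS].
by apply: sphere3_geodesic; rewrite // adj_sym.
Qed.

(** Shifts the path [x u v z] one step on to [u v z w]. A common neighbour of [u] and [w] would be
    in the 2-sphere of [x], which would put [w] in the 3-sphere. *)
Lemma up_geodesic x u v z w : adj x u -> (v, z) \in geodesics x u ->
  w \in up x z -> adj u v /\ (z, w) \in geodesics u v.
Proof.
move=> xu g; have [_ zS] := geodesic_end xu g; move: g.
rewrite in_setD in_setU negb_or => + /andP[/andP[wS2 wS3]].
rewrite !inE /= => /and5P[uv vx vz zu nm] zw.
split=> //; rewrite vz zu zw /=.
have nxz : ~~ adj x z by move: zS; rewrite inE => /and4P[].
have wx : w != x by apply: contraNneq nxz => <-; rewrite adj_sym.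
have nxw : ~~ adj x w.
  by apply: contra nm => xw; apply/meetP; exists w; rewrite // adj_sym.
have nmw : ~~ meet x w by move: wS2; rewrite inE wx.
have -> /= : w != v by apply: contraNneq wS2 => ->; apply/sphere2P; exists u; rewrite ?uv.
apply/meetP => -[p up pw]; case/negP: wS3.
have px : p != x by apply: contraNneq nxw => <-.
rewrite inE wx nxw nmw; apply/existsP; exists p; rewrite pw andbT.
by apply/sphere2P; exists u; rewrite ?up.
Qed.

(** Two such neighbours would continue the edge [u v] to two different geodesics. *)
Lemma card_up_le1 x z : z \in sphere3 x -> #|up x z| <= 1.
Proof.
move=> zS; have /card_gt0P[v vD] := down_gt0 zS.
apply/card_le1_eqP => w w' wU wU'.
have [u xu g] := down_geodesic zS vD.
have [uv g1] := up_geodesic xu g wU; have [_ g2] := up_geodesic xu g wU'.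
by have [] := geodesics_uniq uv g1 g2.
Qed.

(** Read backwards from [w], the edge [w z] would continue through both [v] and [v'], against
    uniqueness of the geodesic. *)
Lemma up_eq0 x z : z \in sphere3 x -> 1 < #|down x z| -> up x z = set0.
Proof.
move=> zS /card_gt1P[v [v' [vD v'D vv']]].
apply/eqP/set0Pn => -[w wU]; case/eqP: vv'.
have [u xu /(up_geodesic xu)/(_ wU)[uv g]] := down_geodesic zS vD.
have [u' xu' /(up_geodesic xu')/(_ wU)[uv' g']] := down_geodesic zS v'D.
have wz : adj w z.
  by move: wU; rewrite in_setD [w \in neighbours z]inE adj_sym => /andP[].
by have [] := geodesics_uniq wz (geodesics_sym uv g) (geodesics_sym uv' g').
Qed.

(** With one neighbour below, at most one lies above and at least [k - 2 >= 2] remain; with more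
    below, none lies above and the bound on [down] leaves two. *)
Lemma across_ge2 x z : z \in sphere3 x -> #|down x z| <= k - 2 ->
  2 <= #|across x z|.
Proof.
move=> zS le; have := card_neighbours_split x z.
have := down_gt0 zS; have := card_up_le1 zS; have := up_eq0 zS.
case: ltnP => [_ /(_ isT)->|]; rewrite ?cards0; lia.
Qed.

(** Counts the walks [z y t] inside the 3-sphere by their end [t]: none ends in [across x z] (no
    triangle), [#|across x z|] return to [z], and at most one ends at any other [t] (no square). *)
Lemma sum_across x z : z \in sphere3 x ->
  \sum_(y in across x z) #|across x y| < #|sphere3 x|.
Proof.
move=> zS.
have -> : \sum_(y in across x z) #|across x y| =
  \sum_(t in sphere3 x) #|across x z :&: neighbours t|.
  transitivity (\sum_(y in across x z) \sum_(t in across x y) 1).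
    by apply: eq_bigr => y _; rewrite sum1_card.
  rewrite (exchange_big_dep (mem (sphere3 x))) /=; last first.
    by move=> y t _; rewrite in_setI => /andP[].
  apply: eq_bigr => t tS; rewrite -sum1_card; apply: eq_bigl => y.
  by rewrite [RHS]in_setI [t \in _]in_setI tS andbT; congr (_ && _); rewrite !inE adj_sym.
rewrite (big_setID (across x z)) /=.
rewrite (eq_bigr (fun=> 0)) ?big1_eq ?add0n => [|t]; last first.
  rewrite in_setI => /andP[_]; rewrite !inE => /andP[zt _].
  apply: eq_card0 => y; rewrite !inE; apply/negP => /andP[/andP[zy _] ty].
  by apply: (tri zt ty); rewrite adj_sym.
have zSA : z \in sphere3 x :\: across x z.
  by rewrite in_setD zS in_setI inE adj_irrefl.
rewrite (big_setD1 z) //= -(cardsID (across x z) (sphere3 x)).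
rewrite (setIidPr (subsetIr _ _)) (setIidPl (subsetIl _ _)).
rewrite (cardsD1 z (_ :\: _)) zSA addnCA ltnS leq_add2l -sum1_card.
apply: leq_sum => t; rewrite !in_setD1 in_setD => /and3P[tz _ tS].
apply/card_le1_eqP => y y'; rewrite !inE => /andP[/andP[zy _] ty].
case/andP=> /andP[zy' _] ty'; apply/eqP/contraT => yy'.
by rewrite (sq ty' ty zy' zy yy') ?eqxx in tz.
Qed.


(* Counting the neighbours inside S = sphere3 x of the d >= 2 neighbours of z in
   S gives d (k - 1) <= (k - (|S| - d)) + (|S| - 1), impossible for k > 3. *)
Lemma down_gt x z : z \in sphere3 x -> k - 2 < #|down x z|.
Proof.
move=> zS; rewrite ltnNge; apply/negP => /(across_ge2 zS) d2.
have subA : sphere3 x :&: across x z = across x z.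
  by apply/setIidPr/subsetIr.
(* Each [y] has at most one neighbour in [up x y], so at least [k - 1] in [down x y] and
   [across x y] together. *)
have lo : #|across x z| * (k - 1) <=
    \sum_(y in across x z) #|down x y| + \sum_(y in across x z) #|across x y|.
  rewrite -sum_nat_const -big_split /=; apply: leq_sum => y.
  rewrite in_setI => /andP[_ yS].
  by have := card_neighbours_split x y; have := card_up_le1 yS; lia.
have up2 := sum_across zS.
have := sum_down x; rewrite (big_setID (across x z)) /= subA => sumk.
have rest : #|sphere3 x :\: across x z| <=
    \sum_(y in sphere3 x :\: across x z) #|down x y|.
  rewrite -sum1_card; apply: leq_sum => y.
  by rewrite in_setD => /andP[_ /down_gt0].
have := cardsID (across x z) (sphere3 x); rewrite subA.
move: d2 lo up2 sumk rest k_gt3.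
move: #|across x z| => d; nia.
Qed.

(** Two vertices would absorb at least [2 * (k - 1) > k] of the [k] edges coming from the
    2-sphere. *)
Lemma card_sphere3 x : #|sphere3 x| = 1.
Proof.
have sumk := sum_down x.
apply/eqP; rewrite eqn_leq card_gt0; apply/andP; split; last first.
  by apply/eqP => S0; move: k_gt3; rewrite -sumk S0 big_set0.
rewrite leqNgt; apply/negP => /card_gt1P[z [z' [zS z'S zz']]].
have := sumk; rewrite (big_setD1 z) //= (big_setD1 z') /=.
  by move: (down_gt zS) (down_gt z'S) k_gt3; lia.
by rewrite in_setD1 eq_sym zz'.
Qed.

(** Being alone in its sphere, [z] receives all [k] edges from the 2-sphere, which exhausts its
    degree. *)
Lemma sphere3_neighbours x z : z \in sphere3 x ->
  neighbours z \subset sphere2 x.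
Proof.
move=> zS; have /eqP/cards1P[z' Sz] := card_sphere3 x.
have := sum_down x; rewrite Sz; move: zS; rewrite Sz inE => /eqP <-.
rewrite big_set1 => dk; apply/setIidPl/eqP.
by rewrite eqEcard subsetIl reg dk leqnn.
Qed.

(** * The component of a vertex as a ball of radius 3 *)

Definition ball x : {set G} :=
  [set x] :|: neighbours x :|: sphere2 x :|: sphere3 x.

Lemma card_ball x : #|ball x| = k * k + 2.
Proof.
have dis (A B : {set G}) : A :&: B = set0 -> #|A :|: B| = #|A| + #|B|.
  by move=> AB; rewrite cardsU AB cards0 subn0.
rewrite /ball !dis ?cards1 ?reg ?card_sphere2 ?card_sphere3.
- by case: k k_gt3 => // n _; lia.
- apply/setP => y; rewrite !inE; case: eqP => //= ->; exact: adj_irrefl.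
- apply/setP => y; rewrite !inE; case: eqP => //= yx.
  by case xy: (adj x y) => //=; rewrite (negPf (adj_meet xy)).
- apply/setP => y; rewrite !inE.
  by case: (y == x); case: (adj x y); case: (meet x y).
Qed.

Lemma ball_closed x y w : y \in ball x -> adj y w -> w \in ball x.
Proof.
rewrite /ball ![y \in _ :|: _]in_setU !in_setU => /orP[/orP[/orP[]|]|] yB yw.
- by rewrite inE in yB; rewrite -(eqP yB) inE [w \in neighbours _]inE yw orbT.
- rewrite inE in yB; have [->|wx] := eqVneq w x; first by rewrite inE eqxx.
  suff -> : w \in sphere2 x by rewrite !orbT.
  by apply/sphere2P; exists y; rewrite ?yw.
- rewrite !inE; have [//|wx] := eqVneq w x.
  case: (adj x w) => //=; case: (meet x w) => //=.
  by apply/existsP; exists y; rewrite yB.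
- have /subsetP/(_ w) := sphere3_neighbours yB.
  by rewrite [w \in neighbours y]inE => /(_ yw)->; rewrite orbT.
Qed.

(** * Rotation of the closed 5-walks in the ball *)

Definition ball_walks x : {set G * G * (G * G * G)} :=
  [set p | (p.1.1 \in ball x) && adj p.1.1 p.1.2 &&
           (p.2 \in closed_walks p.1.1 p.1.2)].

Lemma card_ball_walks x : #|ball_walks x| = (k * k + 2) * k * (k * (k - 2)).
Proof.
rewrite (@card_sigma _ _ (fun d : G * G => (d.1 \in ball x) && adj d.1 d.2)
  (fun d t => t \in closed_walks d.1 d.2)).
rewrite (eq_bigr (fun=> k * (k - 2))) => [|[u v] /= /andP[_ uv]]; last first.
  by rewrite -(card_walks uv); apply: eq_card => t; rewrite inE.
rewrite sum_nat_const -cardsE (@card_sigma _ _ (mem (ball x)) (@adj G)).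
rewrite (eq_bigr (fun=> k)) => [|y _]; first by rewrite sum_nat_const card_ball.
by rewrite -(reg y).
Qed.

Definition rotate (p : G * G * (G * G * G)) : G * G * (G * G * G) :=
  let: (a, b, (c, d, e)) := p in (b, c, (d, e, a)).

(** The walks form a union of orbits of [rotate], each of size exactly 5. *)
Lemma dvd5_ball_walks x : 5 %| #|ball_walks x|.
Proof.
have rot_inj : injective rotate.
  by move=> [[a b] [[c d] e]] [[a' b'] [[c' d'] e']] [-> -> -> -> ->].
rewrite -(@fcard_order_set _ rotate rot_inj 5 (mem (ball_walks x))) ?dvdn_mull //.
- apply/subsetP => -[[a b] [[c d] e]]; rewrite !inE /=.
  case/andP=> /andP[_ ab] /and4P[bc cd de ea].
  pose p := traject rotate (a, b, (c, d, e)) 5.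
  rewrite (order_cycle (p := p)) //= ?inE ?eqxx //.
  (* As 5 is prime, two equal rotations would force all five vertices to be equal, so it suffices
     that consecutive vertices differ. *)
  have [nab [nbc [ncd nde]]] : a <> b /\ b <> c /\ c <> d /\ d <> e.
    by split; [|split; [|split]]; apply/eqP/adj_neq.
  have nea : e <> a by apply/eqP/adj_neq.
  rewrite !negb_or -!andbA.
  by repeat (apply/andP; split) => //; apply/eqP; congruence.
- apply: (intro_closed (fconnect_sym rot_inj)) => p q /eqP <-.
  case: p => [[a b] [[c d] e]]; rewrite inE /= => /andP[/andP[aB ab]].
  rewrite inE => /and4P[/= bc cd de ea].
  by rewrite inE /= (ball_closed aB ab) bc inE /= cd de ea ab.
Qed.

Lemma dvd5_order : 0 < #|G| -> 5 %| (k * k + 2) * k * (k * (k - 2)).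
Proof. by case/card_gt0P=> x _; rewrite -(card_ball_walks x) dvd5_ball_walks. Qed.

End DistanceThree.

(** * The divisibility condition and the two excluded cases *)

Lemma egr_dvd5 v k : 0 < v -> 3 < k ->
  (exists G : sgraph, egr G v k 5 (k * (k - 2))) ->
  5 %| (k * k + 2) * k * (k * (k - 2)).
Proof.
move=> v_gt0 k_gt3 [G [cardG reg girth lam]].
have tri := girth_triangle_free (isT : 3 < 5) girth.
have sq := girth_square_free (isT : 4 < 5) girth.
apply: (dvd5_order k_gt3 reg tri sq); last by rewrite cardG.
move=> u w uw; rewrite -(card_cycles_edge tri sq uw); apply: lam.
by apply/imsetP; exists (u, w); rewrite ?inE.
Qed.

Theorem corollary2 :
  (forall v : nat, 0 < v -> ~ (exists G : sgraph, egr G v 4 5 8)) /\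
  (forall v : nat, 0 < v -> ~ (exists G : sgraph, egr G v 6 5 24)).
Proof.
(* Here [8 = 4 * (4 - 2)] and [24 = 6 * (6 - 2)] hold by computation, and 5 divides neither
   [18 * 4 * 8 = 576] nor [38 * 6 * 24 = 5472]. *)
by split=> v v_gt0; [move/(@egr_dvd5 _ 4 v_gt0 isT)|move/(@egr_dvd5 _ 6 v_gt0 isT)].
Qed.
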